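(* Let $\alpha_1,\dots,\alpha_\sigma$ be distinct complex numbers with $0<|\alpha_i|<1$, and positive integers $s_1,\dots,s_\sigma$. Let $\chi(\theta)=e^{i\theta}$ on $\mathbb{T}$ and set $$g_1=c\prod_{j=1}^{\sigma}(1-\overline{\alpha_j}\chi)^{s_j},\qquad g_2=\prod_{i=1}^{\sigma}(1-\alpha_i\bar\chi)^{s_i},$$ where $c=\prod_{j=1}^\sigma(-\overline{\alpha_j}^{-1})^{s_j}$. For $N\ge 0$ let $\Phi_N=\chi^{N+1}\frac{g_1}{g_2}$ and $\tilde\Phi_N=\chi^{-N-1}\frac{g_2}{g_1}$, and define the Hankel operators $H_{\Phi_N}:H^+(\mathbb{T})\to(H^+(\mathbb{T}))^\perp$, $\psi\mapsto\pi_-(\Phi_N\psi)$, and $H_{\tilde\Phi_N}:(H^+(\mathbb{T}))^\perp\to H^+(\mathbb{T})$, $\psi\mapsto\pi_+(\tilde\Phi_N\psi)$. Let $E$ be the complex vector space spanned by the functions $\frac{1}{(1-\overline{\alpha_j}\chi)^n}$, $1\le j\le\sigma$, $1\le n\le s_j$. Then $E$ is stable under $H_{\tilde\Phi_N}H_{\Phi_N}$, i.e. $H_{\tilde\Phi_N}H_{\Phi_N}(E)\subset E$.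
   Context: $\mathbb{T}=\mathbb{R}/2\pi\mathbb{Z}$ with normalized Lebesgue measure; $H^+(\mathbb{T})=\{\psi\in L^2(\mathbb{T}):\hat\psi(u)=0 \text{ for all } u<0\}$ and $(H^+(\mathbb{T}))^\perp=\{\psi\in L^2(\mathbb{T}):\hat\psi(u)=0\text{ for all }u\ge 0\}$, where $\hat\psi(u)$ is the $u$-th Fourier coefficient. $\pi_+$ and $\pi_-$ are the orthogonal projections of $L^2(\mathbb{T})$ onto $H^+(\mathbb{T})$ and $(H^+(\mathbb{T}))^\perp$ respectively. *)

(* Defs.v *)
(* R : realType, complex numbers R[i] from real_closed. *)
From HB Require Import structures.
From mathcomp Require Import all_boot all_order all_algebra.
From mathcomp Require Import all_classical all_reals all_analysis.
From mathcomp Require Import complex.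
Set Implicit Arguments. Unset Strict Implicit. Unset Printing Implicit Defensive.
Import Order.TTheory GRing.Theory Num.Theory.
Local Open Scope classical_set_scope.
Local Open Scope ring_scope.
Local Open Scope complex_scope.

(* Functions on T = R/2piZ are represented by functions R -> R[i]; only their
   values on the fundamental domain [0, 2pi] matter.  The measure on T is
   Lebesgue measure on [0,2pi] normalised by 1/(2pi). *)

Definition Tdom {R : realType} : set R := `[0%R, (2 * pi)%R].

Definition leb {R : realType} := (@lebesgue_measure R).

(* chi(theta) = e^{i theta} *)
Definition chi (R : realType) (t : R) : R[i] := (cos t +i* sin t).

(* square integrable on T *)
Definition L2 (R : realType) (f : R -> R[i]) : Prop :=
  measurable_fun (@Tdom R) (fun t => complex.Re (f t)) /\
  measurable_fun (@Tdom R) (fun t => complex.Im (f t)) /\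
  (\int[@leb R]_(t in @Tdom R) ((complex.Re (f t)) ^+ 2 + (complex.Im (f t)) ^+ 2)%:E < +oo)%E.

(* u-th Fourier coefficient: (1/2pi) \int_0^{2pi} f(t) e^{-iut} dt *)
Definition fcoef (R : realType) (f : R -> R[i]) (u : int) : R[i] :=
  let g := fun t : R => f t * chi (- (u%:~R * t)) in
  ((2 * pi)^-1)%:C *
  (Rintegral (@leb R) (@Tdom R) (fun t => complex.Re (g t)) +i*
   Rintegral (@leb R) (@Tdom R) (fun t => complex.Im (g t))).

(* g represents pi_+ f in L^2(T) (for f in L^2(T)) *)
Definition is_pi_plus (R : realType) (f g : R -> R[i]) : Prop :=
  L2 g /\ forall u : int, fcoef g u = (if (0 <= u)%R then fcoef f u else 0).

(* g represents pi_- f in L^2(T) *)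
Definition is_pi_minus (R : realType) (f g : R -> R[i]) : Prop :=
  L2 g /\ forall u : int, fcoef g u = (if (u < 0)%R then fcoef f u else 0).

(* equality in L^2(T): equality almost everywhere *)
Definition L2_eq (R : realType) (f g : R -> R[i]) : Prop :=
  {ae @leb R, forall t, @Tdom R t -> f t = g t}.

(* the space E spanned by 1/(1 - conj(alpha_j) chi)^n, 1<=j<=sigma, 1<=n<=s_j *)
Definition in_spanE (R : realType) (sigma : nat) (alpha : 'I_sigma -> R[i])
  (s : 'I_sigma -> nat) (psi : R -> R[i]) : Prop :=
  exists c : 'I_sigma -> nat -> R[i],
    forall t : R, psi t =
      \sum_(j < sigma) \sum_(1 <= n < (s j).+1)
         c j n / (1 - (alpha j)^* * chi t) ^+ n.

Definition cst (R : realType) (sigma : nat) (alpha : 'I_sigma -> R[i])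
  (s : 'I_sigma -> nat) : R[i] :=
  \prod_(j < sigma) (- ((alpha j)^*)^-1) ^+ (s j).

Definition g1 (R : realType) (sigma : nat) (alpha : 'I_sigma -> R[i])
  (s : 'I_sigma -> nat) (t : R) : R[i] :=
  cst alpha s * \prod_(j < sigma) (1 - (alpha j)^* * chi t) ^+ (s j).

Definition g2 (R : realType) (sigma : nat) (alpha : 'I_sigma -> R[i])
  (s : 'I_sigma -> nat) (t : R) : R[i] :=
  \prod_(i < sigma) (1 - alpha i * (chi t)^*) ^+ (s i).

(* Phi_N = chi^{N+1} g1/g2 *)
Definition PhiN (R : realType) (sigma : nat) (alpha : 'I_sigma -> R[i])
  (s : 'I_sigma -> nat) (N : nat) (t : R) : R[i] :=
  chi t ^+ N.+1 * g1 alpha s t / g2 alpha s t.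

(* tilde Phi_N = chi^{-N-1} g2/g1 *)
Definition PhiNt (R : realType) (sigma : nat) (alpha : 'I_sigma -> R[i])
  (s : 'I_sigma -> nat) (N : nat) (t : R) : R[i] :=
  chi t ^- N.+1 * g2 alpha s t / g1 alpha s t.

(* Main.v *)
Require Import Defs.
From mathcomp Require Import all_boot all_order all_algebra.
From mathcomp Require Import all_classical all_reals all_analysis.
From mathcomp Require Import complex measurable_realfun.
From mathcomp Require Import ring lra zify.
Import Order.TTheory GRing.Theory Num.Theory.
Import numFieldNormedType.Exports.
Set Implicit Arguments. Unset Strict Implicit. Unset Printing Implicit Defensive.
Local Open Scope classical_set_scope.
Local Open Scope ring_scope.
Local Open Scope complex_scope.

(** The function [h1] has no Fourier coefficient of index [u >= 0].
    Let [d] be the sum of the [s j], [D = \prod_j (1 - conj (alpha j) X)^(s j)]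
    and [Q = \prod_j (X - alpha j)^(s j)].  On the circle
    [D * PhiNt = cst^-1 * chi^(-N-1-d) * Q], so [D * PhiNt * h1] has no coefficient
    of index [>= 0]; replacing [PhiNt * h1] by its projection [h2] only alters
    the coefficients of [D * PhiNt * h1] of index [< d].  Hence [D * h2] has its
    spectrum in [[0, d[], i.e. [h2 = p(chi) / D(chi)] with [deg p < d], and partial
    fractions conclude.

    Uniqueness of Fourier coefficients: the integral of [f] against any
    trigonometric polynomial vanishes.  The indicator of an arc [[0, x]] is a
    bounded limit of such polynomials, so the primitive of [f] vanishes, and
    Lebesgue differentiation gives [f = 0] a.e. *)

(** * Complex integrals over the circle and rules for Fourier coefficients *)

Section ComplexIntegral.
Variable R : realType.
Implicit Types (f g m : R -> R[i]) (t x : R) (u : int).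

Definition ccontinuous f :=
  continuous (fun t => complex.Re (f t) : R) /\
  continuous (fun t => complex.Im (f t) : R).

Definition cintegrable f :=
  (@leb R).-integrable Tdom (EFin \o (fun t => complex.Re (f t))) /\
  (@leb R).-integrable Tdom (EFin \o (fun t => complex.Im (f t))).

Definition cint f : R[i] :=
  Rintegral (@leb R) Tdom (fun t => complex.Re (f t)) +i*
  Rintegral (@leb R) Tdom (fun t => complex.Im (f t)).

Lemma fcoefE f u :
  fcoef f u = ((2 * pi)^-1)%:C * cint (fun t => f t * chi (- (u%:~R * t))).
Proof. by []. Qed.

Lemma eq_fcoef f g u : f =1 g -> fcoef f u = fcoef g u.
Proof. by move=> /funext->. Qed.

Lemma complex_ReM (z w : R[i]) :
  complex.Re (z * w) = complex.Re z * complex.Re w - complex.Im z * complex.Im w.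
Proof. by case: z; case: w. Qed.

Lemma complex_ImM (z w : R[i]) :
  complex.Im (z * w) = complex.Re z * complex.Im w + complex.Im z * complex.Re w.
Proof. by case: z; case: w. Qed.

Lemma complex_ReD (z w : R[i]) : complex.Re (z + w) = complex.Re z + complex.Re w.
Proof. by case: z; case: w. Qed.

Lemma complex_ImD (z w : R[i]) : complex.Im (z + w) = complex.Im z + complex.Im w.
Proof. by case: z; case: w. Qed.

Lemma ccontinuous_cst (z : R[i]) : ccontinuous (fun=> z).
Proof. by split => x; exact: cvg_cst. Qed.

Lemma ccontinuousD f g :
  ccontinuous f -> ccontinuous g -> ccontinuous (fun t => f t + g t).
Proof.
move=> [f1 f2] [g1 g2]; split.
  by under eq_fun do rewrite complex_ReD; move=> x; apply: cvgD; [exact: f1|exact: g1].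
by under eq_fun do rewrite complex_ImD; move=> x; apply: cvgD; [exact: f2|exact: g2].
Qed.

Lemma ccontinuousM f g :
  ccontinuous f -> ccontinuous g -> ccontinuous (fun t => f t * g t).
Proof.
move=> [f1 f2] [g1 g2]; split.
  under eq_fun do rewrite complex_ReM.
  by move=> x; apply: cvgB; apply: cvgM;
    [exact: f1|exact: g1|exact: f2|exact: g2].
under eq_fun do rewrite complex_ImM.
by move=> x; apply: cvgD; apply: cvgM;
  [exact: f1|exact: g2|exact: f2|exact: g1].
Qed.

Lemma ccontinuousV f :
  ccontinuous f -> (forall t, f t != 0) -> ccontinuous (fun t => (f t)^-1).
Proof.
move=> [f1 f2] f0.
have n0 x : complex.Re (f x) ^+ 2 + complex.Im (f x) ^+ 2 != 0.
  move: (f0 x); case: (f x) => a b /=; apply: contra.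
  rewrite paddr_eq0 ?sqr_ge0// !sqrf_eq0 => /andP[/eqP-> /eqP->].
  by rewrite eq_complex /= eqxx.
have ReV x : complex.Re (f x)^-1 =
    complex.Re (f x) * (complex.Re (f x) ^+ 2 + complex.Im (f x) ^+ 2)^-1.
  by case: (f x).
have ImV x : complex.Im (f x)^-1 =
    - (complex.Im (f x) * (complex.Re (f x) ^+ 2 + complex.Im (f x) ^+ 2)^-1).
  by case: (f x) => a b /=; rewrite ?mulNr.
have nc : continuous
    (fun x => (complex.Re (f x) ^+ 2 + complex.Im (f x) ^+ 2)^-1 : R).
  move=> x; apply: cvgV => //.
  by apply: cvgD; rewrite !expr2; under eq_fun do rewrite expr2; apply: cvgM;
    (exact: f1 || exact: f2).
split.
  by under eq_fun do rewrite ReV; move=> x; apply: cvgM; [exact: f1|exact: nc].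
under eq_fun do rewrite ImV.
by move=> x; apply: cvgN; apply: cvgM; [exact: f2|exact: nc].
Qed.

Lemma measurable_Tdom : measurable (@Tdom R).
Proof. exact: measurable_itv. Qed.
Local Hint Resolve measurable_Tdom : core.

Lemma pi2_gt0 : 0 < 2 * pi :> R.
Proof. by rewrite mulr_gt0// pi_gt0. Qed.

Lemma leb_Tdom : leb (@Tdom R) = (2 * pi)%:E.
Proof.
rewrite /leb /Tdom lebesgue_measure_itv /= lte_fin pi2_gt0.
by rewrite -EFinB subr0.
Qed.

(** [Tdom] is compact, so a continuous factor is bounded there and multiplication by it preserves
    integrability. *)
Lemma continuous_integrableM (h k : R -> R) : continuous h ->
  (@leb R).-integrable Tdom (EFin \o k) ->
  (@leb R).-integrable Tdom (EFin \o (fun t => h t * k t)).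
Proof.
move=> ch ik.
apply: (@integrableMr _ _ _ (@leb R) _ measurable_Tdom h (EFin \o k)) => //.
  by apply: measurable_funTS; exact: continuous_measurable_fun.
have : bounded_set (h @` Tdom).
  apply: compact_bounded; apply: continuous_compact; last exact: segment_compact.
  exact: continuous_subspaceT.
move=> [M [Mr hM]]; exists M; split => // r Mr' x Tx /=.
by apply: (hM r Mr'); exists x.
Qed.

Lemma cintegrableM m f :
  ccontinuous m -> cintegrable f -> cintegrable (fun t => m t * f t).
Proof.
move=> [m1 m2] [f1 f2]; split.
  rewrite (_ : _ \o _ = (fun t =>
    (EFin \o (fun t => (complex.Re (m t) * complex.Re (f t))%R)) t -
    (EFin \o (fun t => (complex.Im (m t) * complex.Im (f t))%R)) t)%E).
    by apply: integrableB => //; exact: continuous_integrableM.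
  by apply/funext => t /=; rewrite complex_ReM.
rewrite (_ : _ \o _ = (EFin \o (fun t => (complex.Re (m t) * complex.Im (f t))%R)) \+
    (EFin \o (fun t => (complex.Im (m t) * complex.Re (f t))%R)))%E.
  by apply: integrableD => //; exact: continuous_integrableM.
by apply/funext => t /=; rewrite complex_ImM.
Qed.

Lemma cintegrableD f g :
  cintegrable f -> cintegrable g -> cintegrable (fun t => f t + g t).
Proof.
move=> [f1 f2] [g1 g2]; split.
  rewrite (_ : _ \o _ = (EFin \o (fun t => complex.Re (f t))) \+
    (EFin \o (fun t => complex.Re (g t))))%E.
    exact: integrableD.
  by apply/funext => t /=; rewrite complex_ReD.
rewrite (_ : _ \o _ = (EFin \o (fun t => complex.Im (f t))) \+
    (EFin \o (fun t => complex.Im (g t))))%E.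
  exact: integrableD.
by apply/funext => t /=; rewrite complex_ImD.
Qed.

Lemma cintD f g : cintegrable f -> cintegrable g ->
  cint (fun t => f t + g t) = cint f + cint g.
Proof.
move=> [f1 f2] [g1 g2]; rewrite /cint.
under eq_Rintegral do rewrite complex_ReD.
rewrite RintegralD//.
by under [X in _ +i* X]eq_Rintegral do rewrite complex_ImD; rewrite RintegralD.
Qed.

Lemma cintegrableZ (z : R[i]) f : cintegrable f -> cintegrable (fun t => z * f t).
Proof. by apply: cintegrableM; exact: ccontinuous_cst. Qed.

Lemma cintZ (z : R[i]) f : cintegrable f -> cint (fun t => z * f t) = z * cint f.
Proof.
move=> [f1 f2]; rewrite /cint.
have iZ (h : R -> R) (a : R) : (@leb R).-integrable Tdom (EFin \o h) ->
    (@leb R).-integrable Tdom (EFin \o (fun t => a * h t)).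
  by apply: continuous_integrableM => x; exact: cvg_cst.
apply/eqP; rewrite eq_complex; apply/andP; split; apply/eqP => /=.
  under eq_Rintegral do rewrite complex_ReM.
  rewrite RintegralB//; [|exact: iZ..].
  by rewrite complex_ReM /= !RintegralZl.
under eq_Rintegral do rewrite complex_ImM.
rewrite RintegralD//; [|exact: iZ..].
by rewrite complex_ImM /= !RintegralZl.
Qed.

Lemma cintegrableB f g :
  cintegrable f -> cintegrable g -> cintegrable (fun t => f t - g t).
Proof.
move=> fi gi; under eq_fun do rewrite -mulN1r.
by apply: cintegrableD => //; exact: cintegrableZ.
Qed.

Lemma cintegrable1 : cintegrable (fun=> 1).
Proof.
have cst_int (a : R) : (@leb R).-integrable Tdom (EFin \o (fun=> a)).
  apply: measurable_bounded_integrable.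
  - exact: measurable_Tdom.
  - by have := ltry (2 * pi : R); rewrite -leb_Tdom.
  - exact: measurable_cst.
  - exact: bounded_cst.
by split; exact: cst_int.
Qed.

Lemma cintegrable_ccontinuous f : ccontinuous f -> cintegrable f.
Proof.
move=> cf; have := cintegrableM cf cintegrable1.
by under [X in cintegrable X -> _]eq_fun do rewrite mulr1.
Qed.

Lemma cintegrable_sum (I : Type) (r : seq I) (F : I -> R -> R[i]) :
  (forall i, cintegrable (F i)) -> cintegrable (fun t => \sum_(i <- r) F i t).
Proof.
move=> iF; elim: r => [|i r ih].
  under eq_fun do rewrite big_nil.
  exact: cintegrable_ccontinuous (ccontinuous_cst 0).
by under eq_fun do rewrite big_cons; exact: cintegrableD.
Qed.

(** The measure of [Tdom] is finite, so [1 + |f|^2] is integrable, and it dominates both the real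
    and the imaginary part. *)
Lemma L2_cintegrable f : L2 f -> cintegrable f.
Proof.
move=> [m1 [m2 fi]].
have i2 : (@leb R).-integrable Tdom
    (EFin \o (fun t => complex.Re (f t) ^+ 2 + complex.Im (f t) ^+ 2)).
  apply/integrableP; split.
    apply/measurable_EFinP; apply: measurable_funD;
    exact: measurable_funX.
  apply: le_lt_trans fi; rewrite le_eqVlt; apply/orP; left; apply/eqP.
  by apply: eq_integral => t _ /=; rewrite ger0_norm// addr_ge0// sqr_ge0.
have i3 : (@leb R).-integrable Tdom
    (EFin \o (fun t => 1 + (complex.Re (f t) ^+ 2 + complex.Im (f t) ^+ 2))).
  by apply: (integrableD _ cintegrable1.1 i2); exact: measurable_Tdom.
split; apply: (le_integrable _ _ _ i3); try exact: measurable_Tdom.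
- exact/measurable_EFinP.
- move=> t _ /=; rewrite lee_fin.
  set a := complex.Re _; set b := complex.Im _.
  rewrite [leRHS]ger0_norm; last by rewrite addr_ge0// addr_ge0// sqr_ge0.
  (* Expanding [(|a| - 1)^2 >= 0] gives [2|a| <= 1 + a^2]. *)
  have := sqr_ge0 (`|a| - 1); have := real_normK (num_real a); have := sqr_ge0 a.
  by have := sqr_ge0 b; nra.
- exact/measurable_EFinP.
- move=> t _ /=; rewrite lee_fin.
  set a := complex.Re _; set b := complex.Im _.
  rewrite [leRHS]ger0_norm; last by rewrite addr_ge0// addr_ge0// sqr_ge0.
  have := sqr_ge0 (`|b| - 1); have := real_normK (num_real b); have := sqr_ge0 b.
  by have := sqr_ge0 a; nra.
Qed.

Lemma chi0 : chi 0 = 1 :> R[i].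
Proof. by rewrite /chi cos0 sin0. Qed.

Lemma chiD t x : chi (t + x) = chi t * chi x.
Proof.
rewrite /chi cosD sinD; apply/eqP; rewrite eq_complex complex_ReM complex_ImM /= eqxx /=.
by apply/eqP; ring.
Qed.

Lemma chiN_mul t : chi (- t) * chi t = 1.
Proof. by rewrite -chiD addNr chi0. Qed.

Lemma chi_neq0 t : chi t != 0.
Proof.
by apply/eqP => h; have := chiN_mul t; rewrite h mulr0 => /esym/eqP; rewrite oner_eq0.
Qed.

Lemma chiV t : (chi t)^-1 = chi (- t).
Proof. by rewrite -[LHS]mul1r -(chiN_mul t) mulfK// chi_neq0. Qed.

Lemma chiX t n : chi t ^+ n = chi (n%:R * t).
Proof.
elim: n => [|n ih]; first by rewrite mul0r chi0.
by rewrite exprS ih -chiD -natr1 mulrDl mul1r addrC.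
Qed.

Lemma chi_conj t : Num.conj (chi t) = chi (- t).
Proof. by rewrite /chi cosN sinN. Qed.

Lemma norm_chi t : `|chi t| = 1.
Proof. by rewrite normc_def /= cos2Dsin2 sqrtr1. Qed.

Lemma ccontinuous_chi (a : R) : ccontinuous (fun t => chi (a * t)).
Proof.
split => x /=; apply: (continuous_comp (f := fun t : R => a * t)).
- exact: mulrl_continuous.
- exact: continuous_cos.
- exact: mulrl_continuous.
- exact: continuous_sin.
Qed.

Lemma cintegrable_fcoef f u :
  cintegrable f -> cintegrable (fun t => f t * chi (- (u%:~R * t))).
Proof.
move=> fi; under eq_fun do rewrite mulrC -mulNr.
exact: cintegrableM (ccontinuous_chi _) fi.
Qed.

Lemma fcoefD f g u : cintegrable f -> cintegrable g ->
  fcoef (fun t => f t + g t) u = fcoef f u + fcoef g u.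
Proof.
move=> fi gi; rewrite !fcoefE -mulrDr -cintD; [|exact: cintegrable_fcoef..].
by congr (_ * cint _); apply/funext => t; rewrite mulrDl.
Qed.

Lemma fcoefZ (z : R[i]) f u : cintegrable f ->
  fcoef (fun t => z * f t) u = z * fcoef f u.
Proof.
move=> fi; rewrite !fcoefE mulrCA -(cintZ z (cintegrable_fcoef u fi)).
by congr (_ * cint _); apply/funext => t; rewrite mulrA.
Qed.

Lemma fcoefB f g u : cintegrable f -> cintegrable g ->
  fcoef (fun t => f t - g t) u = fcoef f u - fcoef g u.
Proof.
move=> fi gi; rewrite -[- fcoef g u]mulN1r -fcoefZ// -fcoefD//.
  by apply: eq_fcoef => t; rewrite mulN1r.
exact: cintegrableZ.
Qed.

Lemma fcoef_sum (I : Type) (r : seq I) (F : I -> R -> R[i]) u :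
  (forall i, cintegrable (F i)) ->
  fcoef (fun t => \sum_(i <- r) F i t) u = \sum_(i <- r) fcoef (F i) u.
Proof.
move=> iF; elim: r => [|i r ih].
  rewrite big_nil; transitivity (fcoef (fun t : R => 0 * 1) u).
    by apply: eq_fcoef => t; rewrite big_nil mul0r.
  by rewrite fcoefZ ?mul0r//; exact: cintegrable1.
rewrite big_cons -ih -fcoefD//; last exact: cintegrable_sum.
by apply: eq_fcoef => t; rewrite big_cons.
Qed.

Lemma fcoef_chi_mul (k : int) f u :
  fcoef (fun t => chi (k%:~R * t) * f t) u = fcoef f (u - k).
Proof.
rewrite !fcoefE; congr (_ * cint _); apply/funext => t.
rewrite [chi _ * f t]mulrC -mulrA -chiD; congr (_ * chi _).
by rewrite intrB; ring.
Qed.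

Lemma ccontinuous_chiX n : ccontinuous (fun t => chi t ^+ n).
Proof. by under eq_fun do rewrite chiX; exact: ccontinuous_chi. Qed.

Lemma ccontinuous_horner_chi (p : {poly R[i]}) :
  ccontinuous (fun t => p.[chi t]).
Proof.
elim/poly_ind: p => [|p c ih].
  by under eq_fun do rewrite horner0; exact: ccontinuous_cst.
under eq_fun do rewrite hornerMXaddC.
apply: ccontinuousD (ccontinuous_cst c); apply: ccontinuousM => //.
exact: (ccontinuous_chiX 1).
Qed.

(** Each monomial of [p] shifts the spectrum, so multiplication by [p(chi)] acts on coefficients as
    a finite convolution. All later statements about the support of a spectrum are read off this
    formula. *)
Lemma fcoef_horner_chi (p : {poly R[i]}) f u : cintegrable f ->
  fcoef (fun t => p.[chi t] * f t) u =
  \sum_(i < size p) p`_i * fcoef f (u - i%:Z).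
Proof.
move=> fi; transitivity (fcoef
  (fun t => \sum_(i < size p) p`_i * (chi (i%:Z%:~R * t) * f t)) u).
  apply: eq_fcoef => t.
  rewrite horner_coef mulr_suml; apply: eq_bigr => i _.
  by rewrite -mulrA chiX.
have ci i : cintegrable (fun t => chi (i%:~R * t) * f t).
  by apply: cintegrableM => //; exact: ccontinuous_chi.
rewrite fcoef_sum; last by move=> i; exact: cintegrableZ.
by apply: eq_bigr => i _; rewrite fcoefZ// fcoef_chi_mul.
Qed.

End ComplexIntegral.

(** * Orthogonality of characters and trigonometric approximation of arcs *)

Section FourierUniqueness.
Variable R : realType.
Implicit Types (f g m : R -> R[i]) (t x : R) (u : int).

Lemma chi_2pi : chi (2 * pi) = 1 :> R[i].
Proof. by rewrite /chi mulr_natl cos2pi sin2pi. Qed.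

Lemma chi_int_2pi u : chi (u%:~R * (2 * pi)) = 1 :> R[i].
Proof.
case: u => n.
  by rewrite -[n%:~R]/(n%:R) -chiX chi_2pi expr1n.
by rewrite NegzE mulrNz mulNr -chiV -[_%:~R]/(n.+1%:R) -chiX chi_2pi expr1n invr1.
Qed.

Lemma Rintegral_derive (F k : R -> R) : continuous k ->
  (forall t, is_derive t (1 : R) F (k t)) ->
  Rintegral (@leb R) Tdom k = F (2 * pi) - F 0.
Proof.
move=> ck dF.
have cF : continuous F.
  by move=> t; apply/differentiable_continuous/derivable1_diffP; exact: ex_derive.
rewrite /Rintegral /leb /Tdom.
rewrite (continuous_FTC2 (F := F)) ?pi2_gt0//.
- exact: continuous_subspaceT.
- split.
  + by move=> t _; exact: ex_derive.
  + by apply: cvg_at_right_filter; exact: cF.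
  + by apply: cvg_at_left_filter; exact: cF.
- by move=> t _; rewrite derive1E; exact: derive_val.
Qed.

(** For [u = 0] the integral is the length of [Tdom]. Otherwise, with [a = - u], the real and
    imaginary parts of [chi (a * t)] have the primitives [a^-1 * sin (a * t)] and
    [- a^-1 * cos (a * t)], which agree at [0] and [2 * pi]. *)
Lemma fcoef1 u : fcoef (fun=> 1) u = (u == 0)%:R :> R[i].
Proof.
rewrite fcoefE; have [->|u0] := eqVneq u 0.
  transitivity (((2 * pi)^-1)%:C * ((2 * pi)%:C) : R[i]); last first.
    by rewrite -rmorphM/= mulVf// gt_eqF// pi2_gt0.
  congr (_ * _); transitivity (cint (fun=> 1 : R[i])).
    by congr cint; apply/funext => t; rewrite mul1r mul0r oppr0 chi0.
  rewrite /cint /= !Rintegral_cst; [|exact: measurable_Tdom..].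
  rewrite mul0r mul1r; apply/eqP; rewrite eq_complex /= eqxx andbT; apply/eqP.
  exact: (congr1 fine (leb_Tdom R)).
pose a : R := - u%:~R.
have a0 : a != 0 by rewrite oppr_eq0 intr_eq0.
have aE t : 1 * chi (- (u%:~R * t)) = chi (a * t) by rewrite mul1r mulNr.
under eq_fun do rewrite aE.
have [ca sa] : (cos (a * (2 * pi)) = 1 :> R) /\ (sin (a * (2 * pi)) = 0 :> R).
  have : chi (a * (2 * pi)) = 1 :> R[i].
    by rewrite /a -[- u%:~R]mulrNz chi_int_2pi.
  by move=> [].
have [c1 c2] := ccontinuous_chi a.
have da t : is_derive t (1 : R) (fun y : R => a * y) a.
  have := is_deriveZ (f := id) a (is_derive_id t (1 : R)).
  by rewrite /GRing.scale /= mulr1.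
have ic : Rintegral (@leb R) Tdom (fun t => complex.Re (chi (a * t))) =
    a^-1 * sin (a * (2 * pi)) - a^-1 * sin (a * 0).
  apply: (@Rintegral_derive (fun t => a^-1 * sin (a * t))) => // t.
  have := is_deriveZ a^-1 (is_derive1_comp (is_derive_sin (a * t)) (da t)).
  by rewrite /GRing.scale /= mulrCA mulVf// mulr1.
have iS : Rintegral (@leb R) Tdom (fun t => complex.Im (chi (a * t))) =
    - a^-1 * cos (a * (2 * pi)) - - a^-1 * cos (a * 0).
  apply: (@Rintegral_derive (fun t => - a^-1 * cos (a * t))) => // t.
  have := is_deriveZ (- a^-1) (is_derive1_comp (is_derive_cos (a * t)) (da t)).
  rewrite /GRing.scale /= (_ : - a^-1 * (- sin (a * t) * a) = sin (a * t))//.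
  by rewrite !mulNr mulrN opprK mulrCA mulVf// mulr1.
by rewrite /cint ic iS !mulr0 sin0 cos0 sa ca mulr0 !subrr mulr0.
Qed.

(** Multipliers that preserve the vanishing of all coefficients form an algebra containing the
    characters, hence every trigonometric polynomial. Continuity is part of the definition so that
    [m * f] is again integrable and products of multipliers can be composed. *)
Definition fourier_multiplier m := ccontinuous m /\
  forall f, cintegrable f -> (forall u, fcoef f u = 0) ->
  forall u, fcoef (fun t => m t * f t) u = 0.

Lemma fourier_multiplier_cst (z : R[i]) : fourier_multiplier (fun=> z).
Proof.
split=> [|f fi f0 u]; first exact: ccontinuous_cst.
by rewrite fcoefZ// f0 mulr0.
Qed.

Lemma fourier_multiplierD m g : fourier_multiplier m -> fourier_multiplier g ->
  fourier_multiplier (fun t => m t + g t).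
Proof.
move=> [mc m0] [gc g0]; split=> [|f fi f0 u]; first exact: ccontinuousD.
rewrite (@eq_fcoef _ _ (fun t => m t * f t + g t * f t)); last first.
  by move=> t; rewrite mulrDl.
by rewrite fcoefD ?m0 ?g0 ?addr0//; exact: cintegrableM.
Qed.

Lemma fourier_multiplierM m g : fourier_multiplier m -> fourier_multiplier g ->
  fourier_multiplier (fun t => m t * g t).
Proof.
move=> [mc m0] [gc g0]; split=> [|f fi f0 u]; first exact: ccontinuousM.
rewrite (@eq_fcoef _ _ (fun t => m t * (g t * f t))); last first.
  by move=> t; rewrite mulrA.
by apply: m0; [exact: cintegrableM|exact: g0].
Qed.

Lemma fourier_multiplierX m n : fourier_multiplier m ->
  fourier_multiplier (fun t => m t ^+ n).
Proof.
move=> hm; elim: n => [|n ih]; first exact: fourier_multiplier_cst.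
by under eq_fun do rewrite exprS; exact: fourier_multiplierM.
Qed.

Lemma fourier_multiplier_chi (k : int) :
  fourier_multiplier (fun t => chi (k%:~R * t)).
Proof.
split=> [|f fi f0 u]; first exact: ccontinuous_chi.
by rewrite fcoef_chi_mul f0.
Qed.

(* The polynomials [(1 - y ^+ n) ^+ (2 ^ n)] converge boundedly on [0, 1] to
   the indicator of [y < 1/2], except at [y = 1/2]. *)
Definition step_poly n (y : R) : R := (1 - y ^+ n) ^+ (2 ^ n).

Lemma step_poly_ge0_le1 n y : 0 <= y <= 1 -> 0 <= step_poly n y <= 1.
Proof.
move=> /andP[y0 y1]; rewrite exprn_ge0 ?exprn_ile1//=.
- by rewrite subr_ge0 exprn_ile1.
- by rewrite gerBl exprn_ge0.
- by rewrite subr_ge0 exprn_ile1.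
Qed.

Lemma bernoulli_sub (h : R) k : 0 <= h <= 1 -> 1 - h *+ k <= (1 - h) ^+ k.
Proof.
move=> /andP[h0 h1]; elim: k => [|k ih]; first by rewrite mulr0n subr0.
rewrite exprS.
apply: le_trans (_ : (1 - h) * (1 - h *+ k) <= _); last first.
  by rewrite ler_wpM2l// subr_ge0.
rewrite mulrSr; have : 0 <= h *+ k by rewrite mulrn_wge0.
by move: (h *+ k) => w w0; nra.
Qed.

(** An upper counterpart of Bernoulli's inequality, by induction from
    [(1 - h)(1 + (k+1)h) <= 1 + kh]. *)
Lemma bernoulli_sub_le (h : R) k : 0 <= h <= 1 -> (1 - h) ^+ k * (1 + h *+ k) <= 1.
Proof.
move=> /andP[h0 h1]; elim: k => [|k ih]; first by rewrite mulr0n addr0 mulr1.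
rewrite exprS mulrAC [_ * _ ^+ k]mulrC; apply: le_trans ih.
rewrite ler_wpM2l ?exprn_ge0 ?subr_ge0// mulrSr.
have : 0 <= h *+ k by rewrite mulrn_wge0.
by move: (h *+ k) => w w0; nra.
Qed.

(** Bernoulli with [h = y^n] and [k = 2^n] squeezes the sequence between [1 - (2y)^n] and [1], where
    [2y < 1]. *)
Lemma step_poly_cvg1 y : 0 <= y < 2^-1 -> step_poly n y @[n --> \oo] --> (1 : R).
Proof.
move=> /andP[y0 y1].
have c0 : (2 * y) ^+ n @[n --> \oo] --> (0 : R).
  by apply: cvg_expr; rewrite ger0_norm ?mulr_ge0//; lra.
apply: (@squeeze_cvgr _ _ _ _ (fun n => 1 - (2 * y) ^+ n) (fun=> 1)).
- apply: nearW => n; apply/andP; split.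
    rewrite exprMn mulrC -natrX mulr_natr; apply: bernoulli_sub.
    by rewrite exprn_ge0//= exprn_ile1//; lra.
  by have /andP[] := @step_poly_ge0_le1 n y ltac:(lra).
- by rewrite -[X in _ --> X]subr0; apply: cvgB => //; exact: cvg_cst.
- exact: cvg_cst.
Qed.

(** With the same [h] and [k], [bernoulli_sub_le] bounds the sequence by [1 / (1 + (2y)^n)], hence
    by [(2y)^-n], where [2y > 1]. *)
Lemma step_poly_cvg0 y : 2^-1 < y <= 1 -> step_poly n y @[n --> \oo] --> (0 : R).
Proof.
move=> /andP[y0 y1].
have y0' : 0 < 2 * y by lra.
have c0 : ((2 * y)^-1) ^+ n @[n --> \oo] --> (0 : R).
  by apply: cvg_expr; rewrite ger0_norm ?invr_ge0 ?(ltW y0')// invf_lt1//; lra.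
apply: (@squeeze_cvgr _ _ _ _ (fun=> 0) (fun n => ((2 * y)^-1) ^+ n)).
- apply: nearW => n; apply/andP; split.
    by have /andP[] := @step_poly_ge0_le1 n y ltac:(lra).
  have /(@bernoulli_sub_le _ (2 ^ n)) : 0 <= y ^+ n <= 1.
    by rewrite exprn_ge0 ?exprn_ile1//; lra.
  rewrite -/(step_poly n y) -[_ *+ (2 ^ n)]mulr_natl natrX -exprMn => h.
  rewrite exprVn -[leRHS]mul1r ler_pdivlMr ?exprn_gt0//.
  apply: le_trans h; rewrite ler_wpM2l ?lerDr//.
  by have /andP[] := @step_poly_ge0_le1 n y ltac:(lra).
- exact: cvg_cst.
- exact: c0.
Qed.

(** A trigonometric polynomial of degree one that crosses the level [1/2] at the ends of the arc
    from [0] to [x]: the cosine centred at the midpoint is compared with its value at the ends. The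
    factor [1/4] keeps the values in [[0, 1]], the domain of [step_poly]. *)
Definition arcf x t : R := 2^-1 - (cos (t - x / 2) - cos (x / 2)) / 4.

Lemma arcfE x t : arcf x t = 2^-1 - sin (t / 2) * sin ((x - t) / 2) / 2.
Proof.
rewrite /arcf; congr (_ - _).
have -> : t - x / 2 = t / 2 - (x - t) / 2 by field.
have -> : x / 2 = t / 2 + (x - t) / 2 by field.
by rewrite cosB cosD; field.
Qed.

Lemma arcf_ge0_le1 x t : 0 <= arcf x t <= 1.
Proof.
rewrite /arcf; have := cos_geN1 (t - x / 2); have := cos_le1 (t - x / 2).
by have := cos_geN1 (x / 2); have := cos_le1 (x / 2); lra.
Qed.

(** Inside the arc, [t/2] and [(x - t)/2] both lie in []0, pi[], so the product of sines in [arcfE]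
    is positive. Outside it, the second sine changes sign, which gives [arcf_gt_half]. *)
Lemma arcf_lt_half x t : 0 < t -> t < x -> x <= 2 * pi -> arcf x t < 2^-1.
Proof.
move=> t0 tx x2; rewrite arcfE.
have : 0 < sin (t / 2) by apply: sin_gt0_pi; lra.
have : 0 < sin ((x - t) / 2) by apply: sin_gt0_pi; lra.
by nra.
Qed.

Lemma arcf_gt_half x t : 0 <= x -> x < t -> t < 2 * pi -> 2^-1 < arcf x t.
Proof.
move=> t0 tx x2; rewrite arcfE.
have -> : (x - t) / 2 = - ((t - x) / 2) by field.
rewrite sinN.
have : 0 < sin (t / 2) by apply: sin_gt0_pi; lra.
have : 0 < sin ((t - x) / 2) by apply: sin_gt0_pi; lra.
by nra.
Qed.

Lemma fourier_multiplier_arc x : fourier_multiplier (fun t => (arcf x t)%:C).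
Proof.
(* The cosine is half the sum of two conjugate characters, whence the coefficient [1/8]; the shift
   by [x/2] becomes a constant phase. *)
have -> : (fun t => (arcf x t)%:C) = (fun t =>
    (2^-1 + cos (x / 2) / 4)%:C +
    ((- 8^-1)%:C * chi (- (x / 2)) * chi (1%:~R * t) +
     (- 8^-1)%:C * chi (x / 2) * chi ((-1)%:~R * t))).
  apply/funext => t; rewrite -!mulrA -!chiD /chi /arcf mulN1r mul1r.
  rewrite [- (x / 2) + t]addrC -[x / 2 - t]opprB cosN sinN.
  by apply/eqP; rewrite eq_complex /=; apply/andP; split; apply/eqP; field.
apply: fourier_multiplierD (fourier_multiplier_cst _) _.
by apply: fourier_multiplierD; apply: fourier_multiplierM (fourier_multiplier_chi _);
  exact: fourier_multiplier_cst.
Qed.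

Lemma fourier_multiplier_step n x :
  fourier_multiplier (fun t => (step_poly n (arcf x t))%:C).
Proof.
have -> : (fun t => (step_poly n (arcf x t))%:C) =
    (fun t => (1 + (-1) * (arcf x t)%:C ^+ n) ^+ (2 ^ n)).
  by apply/funext => t; rewrite /step_poly rmorphXn rmorphB rmorphXn rmorph1 mulN1r.
apply: fourier_multiplierX; apply: fourier_multiplierD (fourier_multiplier_cst _) _.
apply: fourier_multiplierM (fourier_multiplier_cst _) _.
exact: fourier_multiplierX (fourier_multiplier_arc _).
Qed.

(** The integral of multiplier times [f] is, up to the nonzero factor [1/(2 pi)], the coefficient of
    index [0]. Since the multiplier is real, its real and imaginary parts separate. *)
Lemma Rintegral_step_eq0 f n x : cintegrable f -> (forall u, fcoef f u = 0) ->
  Rintegral (@leb R) Tdom (fun t => step_poly n (arcf x t) * complex.Re (f t)) = 0 /\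
  Rintegral (@leb R) Tdom (fun t => step_poly n (arcf x t) * complex.Im (f t)) = 0.
Proof.
move=> fi f0; have [_ /(_ f fi f0 0)] := fourier_multiplier_step n x.
rewrite fcoefE => /eqP; rewrite mulf_eq0 => /orP[|].
  by rewrite eq_complex /= invr_eq0 gt_eqF ?pi2_gt0.
rewrite eq_complex => /andP[/eqP h1 /eqP h2]; split.
  apply: etrans h1; apply: eq_Rintegral => t _.
  by rewrite mul0r oppr0 chi0 mulr1 complex_ReM /= mul0r subr0.
apply: etrans h2; apply: eq_Rintegral => t _.
by rewrite mul0r oppr0 chi0 mulr1 complex_ImM /= mul0r addr0.
Qed.
End FourierUniqueness.

(** * Uniqueness almost everywhere, and functions of finite spectrum *)

Lemma ae_neq (R : realType) (a : R) : {ae @leb R, forall t, t != a}.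
Proof.
exists [set a]; split.
- exact: measurable_set1.
- exact: lebesgue_measure_set1.
- by move=> t /= /negP; rewrite negbK => /eqP.
Qed.

(** Dominated convergence with majorant [|k|]: the step functions tend to the indicator of
    [[0, x]]. *)
Lemma Rintegral_step_limit (R : realType) (k : R -> R) (x : R) :
  (@leb R).-integrable Tdom (EFin \o k) -> 0 <= x <= 2 * pi ->
  (forall n, Rintegral (@leb R) Tdom (fun t => step_poly n (arcf x t) * k t) = 0) ->
  Rintegral (@leb R) `[0, x]%classic k = 0.
Proof.
move=> ik /andP[x0 x2] k0.
have ik_ n : (@leb R).-integrable Tdom
    (EFin \o (fun t => step_poly n (arcf x t) * k t)).
  by apply: continuous_integrableM => //; exact: (fourier_multiplier_step n x).1.1.
have subT : (Tdom `&` `[0, x]%classic : set R) = `[0, x]%classic.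
  apply/seteqP; split => [t []//|t tx]; split=> //.
  by move: tx; rewrite /Tdom /= !in_itv /= => /andP[-> /= /le_trans]; apply.
have mT : measurable (@Tdom R : set (measurableTypeR R)) by exact: measurable_itv.
have := @dominated_convergence _ _ _ (@leb R) Tdom mT
  (fun n => EFin \o (fun t => step_poly n (arcf x t) * k t))
  (EFin \o (k \_ `[0, x]%classic)) (EFin \o (fun t => `|k t|)).
case.
- by move=> n; exact: measurable_int (ik_ n).
- have mx : measurable (`[0, x]%classic : set (measurableTypeR R)).
    exact: measurable_itv.
  apply/measurable_EFinP; apply: (measurable_restrict k mx mT).1.
  apply: (measurable_funS mT); first exact: subIsetl.
  by apply/measurable_EFinP; exact: measurable_int ik.
(* At [0], [x] and [2 * pi] the value of [arcf x] is exactly [1/2], where the limit of [step_poly]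
   is not controlled. *)
- have := ae_neq (2 * pi : R); have := ae_neq x; have := ae_neq (0 : R).
  apply: filterS3; first exact: (ae_filter_ringOfSetsType (@leb R)).
  move=> t t0 tx t2; rewrite /Tdom /= in_itv /= => /andP[t0' t2'].
  have {t0'}t0 : 0 < t by rewrite lt_neqAle eq_sym t0.
  have {t2'}t2 : t < 2 * pi by rewrite lt_neqAle t2.
  apply: cvg_EFin; first exact: nearW.
  rewrite patchE; case: ifPn => [|].
    rewrite inE /= in_itv /= => /andP[_ tx'].
    rewrite -[X in _ --> X]mul1r; apply: cvgM; last exact: cvg_cst.
    apply: step_poly_cvg1; have /andP[-> _] /= := arcf_ge0_le1 x t.
    by apply: arcf_lt_half => //; rewrite lt_neqAle tx.
  move=> /negP; rewrite inE /= in_itv /= (ltW t0) /= => /negP; rewrite -ltNge => xt.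
  rewrite -[X in _ --> X](mul0r (k t)); apply: cvgM; last exact: cvg_cst.
  apply: step_poly_cvg0; have /andP[_ ->] := arcf_ge0_le1 x t.
  by rewrite andbT; exact: arcf_gt_half.
- by have := integrable_abse ik.
- apply: aeW => t n _ /=; rewrite lee_fin normrM ler_piMl//.
  by have /andP[? ?] := step_poly_ge0_le1 n (arcf_ge0_le1 x t); rewrite ger0_norm.
move=> iki _ /= hcvg.
rewrite -subT Rintegral_mkcondr /Rintegral.
have /cvg_lim <- // := hcvg.
rewrite (_ : (fun n => _) = (fun=> 0)%E) ?lim_cst//.
apply/funext => n; rewrite -[LHS]fineK; last exact: integrable_fin_num (ik_ n).
by rewrite [X in X%:E](k0 n).
Qed.

(** Extended by zero outside [Tdom], [k] has a primitive from [0] that vanishes on the whole line;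
    Lebesgue differentiation recovers [k] as its derivative almost everywhere. *)
Lemma ae_eq0_of_primitive (R : realType) (k : R -> R) :
  (@leb R).-integrable Tdom (EFin \o k) ->
  (forall x, 0 <= x <= 2 * pi -> Rintegral (@leb R) `[0, x]%classic k = 0) ->
  {ae @leb R, forall t, Tdom t -> k t = 0}.
Proof.
move=> ik k0.
pose kT := k \_ (@Tdom R).
have ikT : (@leb R).-integrable setT (EFin \o kT).
  have mT : measurable (@Tdom R : set (measurableTypeR R)).
    exact: measurable_itv.
  by have := (integrable_mkcond _ mT).1 ik; rewrite restrict_EFin.
have F0 : (fun x => Rintegral (@leb R) `[0, x]%classic kT) = fun=> 0.
  apply/funext => x; rewrite -Rintegral_mkcondr.
  (* For [x < 0] the interval is empty; beyond [2 * pi] the integral is that over all of [Tdom]. *)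
  have [x0|x0] := ltP x 0.
    by rewrite set_itv_ge ?set0I ?Rintegral_set0// bnd_simp -ltNge.
  have [x2|x2] := leP x (2 * pi).
    rewrite (_ : _ `&` _ = `[0, x]%classic) ?k0 ?x0//.
    apply/seteqP; split => [t []//|t tx]; split=> //.
    by move: tx; rewrite /Tdom /= !in_itv /= => /andP[-> /= /le_trans]; apply.
  rewrite (_ : _ `&` _ = `[0, 2 * pi]%classic) ?k0 ?lexx ?(ltW (pi2_gt0 _))//.
  apply/seteqP; split => [t []//|t tx]; split=> //.
  move: tx; rewrite /= !in_itv /= => /andP[-> /= /le_trans]; apply; exact: ltW.
have iy (y : R) : (@leb R).-integrable `[0, y]%classic (EFin \o kT).
  by apply: integrableS ikT => //; exact: measurable_itv.
have lT : locally_integrable setT kT.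
  by apply: integrable_locally ik; exact: measurable_itv.
have ftc := FTC1 iy lT.
(* The primitive starts at [0], so differentiation applies only at [t > 0], and the point [0] is
   discarded. *)
apply: filterS2 ftc (ae_neq 0); first exact: (ae_filter_ringOfSetsType (@leb R)).
move=> t /= ht t0 Tt; move: (Tt); rewrite /Tdom /= in_itv /= => /andP[t0' _].
have {ht} [|_] := ht; first by rewrite lte_fin lt_neqAle eq_sym t0.
by rewrite F0 derive1_cst /kT patchE mem_set.
Qed.

Lemma fcoef_eq0_ae (R : realType) (f : R -> R[i]) :
  cintegrable f -> (forall u, fcoef f u = 0) ->
  {ae @leb R, forall t, Tdom t -> f t = 0}.
Proof.
move=> fi f0; have [fr fim] := fi.
have hr := ae_eq0_of_primitive fr (fun x hx => Rintegral_step_limit fr hx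
  (fun n => (Rintegral_step_eq0 n x fi f0).1)).
have hi := ae_eq0_of_primitive fim (fun x hx => Rintegral_step_limit fim hx
  (fun n => (Rintegral_step_eq0 n x fi f0).2)).
apply: filterS2 hr hi; first exact: (ae_filter_ringOfSetsType (@leb R)).
move=> t ht1 ht2 Tt; apply/eqP; rewrite eq_complex.
by apply/andP; split; apply/eqP; [exact: ht1|exact: ht2].
Qed.

(** The polynomial built from the coefficients of [f] has the same spectrum as [f], so uniqueness
    applies to the difference. *)
Lemma fcoef_supp_ae_horner (R : realType) (f : R -> R[i]) (d : nat) :
  cintegrable f -> (forall u : int, u < 0 -> fcoef f u = 0) ->
  (forall u : int, d%:Z <= u -> fcoef f u = 0) ->
  exists2 p : {poly R[i]}, (size p <= d)%N &
    {ae @leb R, forall t, Tdom t -> f t = p.[chi t]}.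
Proof.
move=> fi fneg fd; pose p := \poly_(k < d) fcoef f k%:Z.
have pi' : cintegrable (fun t : R => p.[chi t]).
  exact/cintegrable_ccontinuous/ccontinuous_horner_chi.
have pf u : fcoef (fun t => p.[chi t]) u = fcoef f u.
  (* The factor [1] has spectrum [{0}], so the convolution formula picks out a single coefficient of
     [p]. *)
  rewrite (@eq_fcoef _ _ (fun t => p.[chi t] * 1)); last by move=> t; rewrite mulr1.
  rewrite fcoef_horner_chi; last exact: cintegrable1.
  under eq_bigr do rewrite fcoef1 subr_eq0.
  case: u => [n|n]; last first.
    by rewrite fneg// big1// => i _; rewrite mulr0.
  have [np|pn] := ltnP n (size p).
    rewrite (bigD1 (Ordinal np)) //= eqxx mulr1 big1 ?addr0.
      by rewrite coef_poly (leq_trans np (size_poly _ _)).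
    by move=> i; rewrite -val_eqE /= eq_sym => /negPf; rewrite eqz_nat => ->; rewrite mulr0.
  rewrite big1; last first.
    by move=> i _; rewrite eqz_nat gtn_eqF ?mulr0// (leq_trans (ltn_ord i)).
  (* The size of [p] may be less than [d]; for [n] in between, the coefficient of [p], which is that
     of [f], is zero. *)
  have [nd|dn] := ltnP n d; last by rewrite fd// lez_nat.
  by have := nth_default 0 pn; rewrite coef_poly nd.
exists p; first exact: size_poly.
have h : {ae @leb R, forall t, Tdom t -> f t - p.[chi t] = 0}.
  apply: fcoef_eq0_ae => [|u]; first exact: cintegrableB.
  by rewrite fcoefB// pf subrr.
apply: filterS h; first exact: (ae_filter_ringOfSetsType (@leb R)).
by move=> t ht Tt; apply/eqP; rewrite -subr_eq0; apply/eqP/ht.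
Qed.

(** * Partial fractions over a field *)

Section PartialFractions.
Variable F : fieldType.

Lemma size_prod_exp_leq (n : nat) (P : pred 'I_n) (L : 'I_n -> {poly F})
    (s : 'I_n -> nat) : (forall j, (size (L j) <= 2)%N) ->
  (size (\prod_(j < n | P j) L j ^+ s j)%R <= (\sum_(j < n | P j) s j).+1)%N.
Proof.
move=> L2.
apply: (big_rec2 (fun (p : {poly F}) k => (size p <= k.+1)%N)).
  by rewrite size_poly1.
move=> j k p _ hp; apply: (leq_trans (size_polyMleq _ _)).
have hj : (size (L j ^+ s j)%R <= (s j).+1)%N.
  apply: (leq_trans (size_poly_exp_leq _ _)).
  by have := L2 j; case: (size (L j)) => [|[|[|]]]//= _; rewrite ?mul0n ?mul1n.
by move: hp hj; lia.
Qed.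

(** Induction on the total multiplicity: subtracting the term of highest order at one pole lets a
    factor cancel. Multiplicities may drop to zero along the way. *)
Lemma partial_fractions (n : nat) (b : 'I_n -> F) (s : 'I_n -> nat) (p : {poly F}) :
  injective b -> (forall j, b j != 0) -> (size p <= \sum_(j < n) s j)%N ->
  exists c : 'I_n -> nat -> F, forall x, (forall j, 1 - b j * x != 0) ->
    p.[x] / \prod_(j < n) (1 - b j * x) ^+ s j =
    \sum_(j < n) \sum_(1 <= k < (s j).+1) c j k / (1 - b j * x) ^+ k.
Proof.
move=> binj b0.
move: {-2}(\sum_(j < n) s j)%N (erefl (\sum_(j < n) s j)%N) => d.
elim: d s p => [|d ih] s p sd szp.
  exists (fun _ _ => 0) => x _; move: szp; rewrite leqn0 size_poly_eq0 => /eqP->.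
  rewrite horner0 mul0r big1// => j _; rewrite big1// => k _.
  by rewrite mul0r.
have [j0 sj0] : exists j0, (0 < s j0)%N.
  apply/existsP; rewrite -[X in is_true X]negbK negb_exists; apply/negP => /forallP h.
  by move: sd; rewrite big1// => j _; apply/eqP; rewrite -leqn0 leqNgt.
pose L j : {poly F} := 1 - b j *: 'X.
have L2 j : (size (L j) <= 2)%N.
  apply: (leq_trans (size_polyD _ _)); rewrite size_poly1 size_polyN.
  by rewrite geq_max /= (leq_trans (size_scale_leq _ _))// size_polyX.
have LE j x : (L j).[x] = 1 - b j * x by rewrite !hornerE.
pose G := \prod_(j < n | j != j0) L j ^+ s j.
pose z := (b j0)^-1.
(* A zero at [z = 1 / b j0] would force [b j = b j0] for some [j != j0]. *)
have Gz : G.[z] != 0.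
  rewrite horner_prod prodf_seq_neq0; apply/allP => j _; apply/implyP => jj0.
  rewrite horner_exp LE expf_neq0// subr_eq0 eq_sym; apply: contra jj0 => /eqP h.
  by apply/eqP/binj; rewrite -[b j](mulfK (b0 j0)) -mulrA [b j0 * _]mulrC mulrA h mul1r.
(* Chosen so that [p - a G] vanishes at the pole [z]. *)
pose a := p.[z] / G.[z].
have sdE : (\sum_(j < n) s j = s j0 + \sum_(j < n | j != j0) s j)%N by rewrite (bigD1 j0).
have /factor_theorem[q qE] : root (p - a *: G) z.
  by rewrite /root !hornerE /a divfK// subrr.
have zb : z * b j0 = 1 by rewrite mulVf.
(* Rescaling from the monic factor: [X - z = - z (1 - b j0 X)]. *)
pose q' := (- z) *: q.
have qE' : p - a *: G = q' * L j0.
  rewrite qE /q' /L -scalerAl scalerAr; congr (_ * _).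
  by rewrite scalerBr scalerA mulNr zb !scaleNr scale1r opprK addrC alg_polyC.
have szq : (size q' <= d)%N.
  apply: (leq_trans (size_scale_leq _ _)).
  have [->|q0] := eqVneq q 0; first by rewrite size_poly0.
  (* Since [s j0 > 0], the degree of [G] is at most [d]. *)
  have : (size (p - a *: G)%R <= d.+1)%N.
    apply: (leq_trans (size_polyD _ _)); rewrite size_polyN geq_max szp /=.
    apply: (leq_trans (size_scale_leq _ _)).
    apply: (leq_trans (size_prod_exp_leq _ _ L2)).
    by move: sd; rewrite sdE; lia.
  by rewrite qE size_Mmonic ?monicXsubC// size_XsubC addn2.
pose s' j := (s j - (j == j0))%N.
have s'j0 : s j0 = (s' j0).+1 by rewrite /s' eqxx subn1 prednK.
have s'E j : j != j0 -> s' j = s j by move=> /negPf jj; rewrite /s' jj subn0.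
have sd' : (\sum_(j < n) s' j = d)%N.
  rewrite (bigD1 j0)//= (eq_bigr s); last by move=> j; exact: s'E.
  by move: sd; rewrite sdE s'j0 addSn => -[].
have [c' c'E] := ih s' q' (esym sd') szq.
exists (fun j k => if (j == j0) && (k == s j0) then a else c' j k) => x Lx.
have dE : \prod_(j < n) (1 - b j * x) ^+ s j =
    (1 - b j0 * x) ^+ s j0 * G.[x].
  rewrite (bigD1 j0)//= /G horner_prod; congr (_ * _).
  by apply: eq_bigr => j _; rewrite horner_exp LE.
have dE' : \prod_(j < n) (1 - b j * x) ^+ s' j =
    (1 - b j0 * x) ^+ s' j0 * G.[x].
  rewrite (bigD1 j0)//= /G horner_prod; congr (_ * _).
  by apply: eq_bigr => j jj; rewrite horner_exp LE s'E.
have Gx : G.[x] != 0.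
  rewrite horner_prod prodf_seq_neq0; apply/allP => j _; apply/implyP => _.
  by rewrite horner_exp LE expf_neq0.
have pE : p.[x] = a * G.[x] + q'.[x] * (1 - b j0 * x).
  by rewrite -LE -hornerM -qE' hornerD hornerN hornerZ addrC subrK.
have : p.[x] / \prod_(j < n) (1 - b j * x) ^+ s j =
    a / (1 - b j0 * x) ^+ s j0 + q'.[x] / \prod_(j < n) (1 - b j * x) ^+ s' j.
  rewrite dE dE' pE s'j0 exprS; have := Lx j0; move: (1 - _) => l l0.
  by field; rewrite l0 Gx expf_neq0.
move=> ->; rewrite c'E// (bigD1 j0)//= [RHS](bigD1 j0)//= addrA; congr (_ + _).
  rewrite s'j0 [RHS]big_nat_recr//= !eqxx addrC; congr (_ + _).
  by apply: eq_big_nat => k /andP[_ km]; rewrite ltn_eqF.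
by apply: eq_bigr => j jj; rewrite s'E// (negPf jj).
Qed.
End PartialFractions.

Lemma one_sub_conj_chi_neq0 (R : realType) (a : R[i]) (t : R) :
  `|a| < 1 -> 1 - Num.conj a * chi t != 0.
Proof.
move=> a1; rewrite subr_eq0; apply/eqP => /(congr1 Num.norm).
by rewrite normrM norm_conjC norm_chi mulr1 normr1 => h; rewrite -h ltxx in a1.
Qed.

(** * The symbol as a rational function of [chi], and the range of its Hankel operator *)

Section Hankel.
Variables (R : realType) (sigma : nat) (alpha : 'I_sigma -> R[i]).
Variables (s : 'I_sigma -> nat) (N : nat).
Hypothesis alpha_pos : forall j, 0 < `|alpha j|.
Hypothesis alpha_lt1 : forall j, `|alpha j| < 1.

Let d : nat := \sum_(j < sigma) s j.
Let D : {poly R[i]} := \prod_(j < sigma) (1 - Num.conj (alpha j) *: 'X) ^+ s j.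
Let Q : {poly R[i]} := \prod_(j < sigma) ('X - (alpha j)%:P) ^+ s j.

Lemma denominator_chi t :
  D.[chi t] = \prod_(j < sigma) (1 - Num.conj (alpha j) * chi t) ^+ s j.
Proof.
by rewrite horner_prod; apply: eq_bigr => j _; rewrite horner_exp !hornerE.
Qed.

Lemma denominator_chi_neq0 t : D.[chi t] != 0.
Proof.
rewrite denominator_chi prodf_seq_neq0; apply/allP => j _; apply/implyP => _.
by rewrite expf_neq0// one_sub_conj_chi_neq0.
Qed.

Lemma size_denominator : (size D <= d.+1)%N.
Proof.
apply: size_prod_exp_leq => j.
apply: (leq_trans (size_polyD _ _)); rewrite size_poly1 size_polyN.
by rewrite geq_max /= (leq_trans (size_scale_leq _ _))// size_polyX.
Qed.

Lemma size_numerator : (size Q <= d.+1)%N.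
Proof. by apply: size_prod_exp_leq => j; rewrite size_XsubC. Qed.

Lemma g1_chi t : g1 alpha s t = Defs.cst alpha s * D.[chi t].
Proof. by rewrite denominator_chi. Qed.

(** On the circle the conjugate of [chi] is its inverse, so each factor [1 - alpha conj(chi)] equals
    [chi^-1 (chi - alpha)]. *)
Lemma g2_chi t : g2 alpha s t = chi t ^- d * Q.[chi t].
Proof.
have cd0 : chi t ^+ d != 0 by rewrite expf_neq0// chi_neq0.
apply: (mulfI cd0); rewrite mulrA mulfV// mul1r horner_prod /d expr_sum -big_split.
apply: eq_bigr => j _ /=; rewrite -exprMn horner_exp !hornerE.
by rewrite mulrBr mulr1 mulrCA chi_conj [chi t * _]mulrC chiN_mul mulr1.
Qed.

Lemma PhiNt_chi t : PhiNt alpha s N t = (Defs.cst alpha s)^-1 *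
  chi ((- (N.+1 + d)%:Z)%:~R * t) * (Q.[chi t] / D.[chi t]).
Proof.
rewrite /PhiNt g1_chi g2_chi mulrNz mulNr -chiV -[_%:~R]/((N.+1 + d)%:R) -chiX.
rewrite exprD !invfM.
by ring.
Qed.

Lemma ccontinuous_PhiNt : ccontinuous (PhiNt alpha s N).
Proof.
rewrite (funext PhiNt_chi).
apply: ccontinuousM.
  exact: ccontinuousM (ccontinuous_cst _) (ccontinuous_chi _).
apply: ccontinuousM; first exact: ccontinuous_horner_chi.
apply: ccontinuousV; first exact: ccontinuous_horner_chi.
exact: denominator_chi_neq0.
Qed.

Lemma hankel_range (h1 h2 : R -> R[i]) : injective alpha ->
  L2 h1 -> (forall u : int, 0 <= u -> fcoef h1 u = 0) ->
  is_pi_plus (fun t => PhiNt alpha s N t * h1 t) h2 ->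
  exists phi : R -> R[i], in_spanE alpha s phi /\ L2_eq h2 phi.
Proof.
move=> alpha_inj /L2_cintegrable h1i h1neg [/L2_cintegrable h2i h2E].
have fi := cintegrableM ccontinuous_PhiNt h1i.
have Dh2i := cintegrableM (ccontinuous_horner_chi D) h2i.
have Qh1i := cintegrableM (ccontinuous_horner_chi Q) h1i.
have Dh2_neg (u : int) : u < 0 -> fcoef (fun t => D.[chi t] * h2 t) u = 0.
  move=> u0; rewrite fcoef_horner_chi// big1// => i _.
  (* Multiplying by [D] only moves frequencies up, so indices [u - i] with [u < 0] stay negative. *)
  by rewrite h2E ifF ?mulr0//; lia.
have Dh2_ge (u : int) : d%:Z <= u -> fcoef (fun t => D.[chi t] * h2 t) u = 0.
  move=> ud; rewrite fcoef_horner_chi//.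
  (* For [u >= d] and [i <= d] the index [u - i] is nonnegative, where [h2] and [PhiNt * h1] have
     equal coefficients. *)
  transitivity (fcoef (fun t => D.[chi t] * (PhiNt alpha s N t * h1 t)) u).
    rewrite fcoef_horner_chi//; apply: eq_bigr => i _; rewrite h2E ifT//.
    by have := leq_trans (ltn_ord i) size_denominator; lia.
  rewrite (@eq_fcoef _ _ (fun t => (Defs.cst alpha s)^-1 *
      (chi ((- (N.+1 + d)%:Z)%:~R * t) * (Q.[chi t] * h1 t)))); last first.
    move=> t; rewrite PhiNt_chi; have D0 := denominator_chi_neq0 t.
    by rewrite mulrC -!mulrA; congr (_ * (_ * (_ * _))); rewrite mulrCA mulVf// mulr1.
  rewrite fcoefZ; last exact: cintegrableM (ccontinuous_chi _) Qh1i.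
  rewrite fcoef_chi_mul fcoef_horner_chi// big1 ?mulr0// => i _.
  rewrite h1neg ?mulr0//.
  (* The index is [u + N + 1 + d - i] with [i <= d], hence nonnegative. *)
  by have := leq_trans (ltn_ord i) size_numerator; lia.
have [p pd pE] := fcoef_supp_ae_horner Dh2i Dh2_neg Dh2_ge.
have conj_inj : injective (fun j => Num.conj (alpha j)).
  by move=> i j /(can_inj conjCK) /alpha_inj.
have conj_neq0 j : Num.conj (alpha j) != 0 by rewrite conjC_eq0 -normr_gt0.
have [c cE] := partial_fractions conj_inj conj_neq0 pd.
exists (fun t => \sum_(j < sigma) \sum_(1 <= n < (s j).+1)
         c j n / (1 - Num.conj (alpha j) * chi t) ^+ n); split; first by exists c.
apply: filterS pE; first exact: (ae_filter_ringOfSetsType (@leb R)).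
move=> t pt Tt; rewrite -cE; last by move=> j; exact: one_sub_conj_chi_neq0.
rewrite -denominator_chi -pt// mulrC mulKf//.
exact: denominator_chi_neq0.
Qed.

End Hankel.

Theorem mainTheorem3 (R : realType) (sigma : nat) (alpha : 'I_sigma -> R[i])
  (s : 'I_sigma -> nat) (N : nat)
  (alpha_inj : injective alpha)
  (alpha_pos : forall j, 0 < `|alpha j|)
  (alpha_lt1 : forall j, `|alpha j| < 1)
  (s_pos : forall j, (0 < s j)%N) :
  forall psi : R -> R[i], in_spanE alpha s psi ->
  forall h1 : R -> R[i], is_pi_minus (fun t => PhiN alpha s N t * psi t) h1 ->
  forall h2 : R -> R[i], is_pi_plus (fun t => PhiNt alpha s N t * h1 t) h2 ->
  exists phi : R -> R[i], in_spanE alpha s phi /\ L2_eq h2 phi.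
Proof.
move=> psi _ h1 [h1L2 h1E] h2; apply: hankel_range => // u u0.
by rewrite h1E ltNge u0.
Qed.
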